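(* Let $\mathsf{k}$ be an algebraically closed field and let $A_1,\dots,A_r$ ($r\ge1$) be finite-dimensional $\mathsf{k}$-algebras. Then $$\mathsf{FPdim}\Big(\prod_{i=1}^rA_i\Big)=\max_{1\le i\le r}\mathsf{FPdim}(A_i).$$
   Context: $\mathsf{k}$ is an algebraically closed field. An algebra means a finite-dimensional $\mathsf{k}$-algebra, not assumed connected; modules are finitely generated right modules, and $\mathsf{mod}\,A$ is the category of such $A$-modules. A module $S$ is a brick if $\mathrm{End}_A(S)$ is a division ring (equivalently $\mathrm{End}_A(S)\simeq\mathsf{k}$). A semibrick is a (possibly empty) set $\mathcal S$ of pairwise non-isomorphic bricks with $\mathrm{Hom}_A(S,S')=0$ for all non-isomorphic $S,S'\in\mathcal S$. For a finite semibrick $\mathcal S$, the $\mathrm{Ext}$-quiver $Q_{\mathcal S}$ has vertex set $\mathcal S$ and exactly $\dim_{\mathsf k}\mathrm{Ext}^1_A(S,S')$ arrows from $S$ to $S'$ (loops included). For a quiver $Q$, $\rho(Q)$ is the spectral radius (largest modulus of an eigenvalue) of its adjacency matrix, with $\rho=0$ for the empty quiver. The Frobenius--Perron dimension of $A$ is $\mathsf{FPdim}(A)=\sup\{\rho(Q_{\mathcal S})\mid \mathcal S \text{ a finite semibrick in } \mathsf{mod}\,A\}\in[0,\infty]$. *)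

(* Defs.v *)
From HB Require Import structures.
From mathcomp Require Import all_boot all_order all_algebra.
From mathcomp Require Import all_classical all_reals ereal.
From mathcomp Require Import complex.

Set Implicit Arguments.
Unset Strict Implicit.
Unset Printing Implicit Defensive.

Import Order.TTheory GRing.Theory Num.Theory.
Local Open Scope ring_scope.

(* Finite-dimensional unital associative k-algebras. The library's falgType
   asks for 1 != 0; only this restriction is dropped here, so that the zero
   algebra is allowed. See fdalg_of_falg at the end of the file. *)
HB.mixin Record isFdAlgebra (k : fieldType) A of Vector k A := {
  fdone : A;
  fdmul : A -> A -> A;
  fdmulA : associative fdmul;
  fdmul1l : left_id fdone fdmul;
  fdmul1r : right_id fdone fdmul;
  fdmul_linear_l : forall y : A, linear (fdmul^~ y);
  fdmul_linear_r : forall x : A, linear (fdmul x)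
}.

#[short(type="fdAlgType")]
HB.structure Definition FdAlgebra (k : fieldType) :=
  { A of isFdAlgebra k A & Vector k A }.

Section FdAlgebraRing.
Variables (k : fieldType) (A : fdAlgType k).
Implicit Types x y z : A.

Fact fdmulDl : left_distributive (@fdmul k A) +%R.
Proof. by move=> x y z; have := fdmul_linear_l z 1 x y; rewrite !scale1r. Qed.
Fact fdmulDr : right_distributive (@fdmul k A) +%R.
Proof. by move=> x y z; have := fdmul_linear_r x 1 y z; rewrite !scale1r. Qed.

HB.instance Definition _ := GRing.Zmodule_isPzRing.Build A
  (@fdmulA k A) (@fdmul1l k A) (@fdmul1r k A) fdmulDl fdmulDr.

Lemma fd_scalerAl (c : k) x y : c *: (x * y) = (c *: x) * y.
Proof.
by have := fdmul_linear_l y c x 0; rewrite !addr0 (mul0r y : fdmul 0 y = 0) addr0.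
Qed.
Lemma fd_scalerAr (c : k) x y : c *: (x * y) = x * (c *: y).
Proof.
by have := fdmul_linear_r x c y 0; rewrite !addr0 (mulr0 x : fdmul x 0 = 0) addr0.
Qed.

End FdAlgebraRing.

Section ProductAlgebra.
Import VectorInternalTheory.
Variables (k : fieldType) (I : finType) (A : I -> fdAlgType k).

Definition prodalg := {dffun forall i : I, A i}.

HB.instance Definition _ := Choice.on prodalg.

Implicit Types x y z : prodalg.

Let zero : prodalg := [ffun i => 0 : A i].
Let one : prodalg := [ffun i => 1 : A i].
Let opp x : prodalg := [ffun i => - x i : A i].
Let add x y : prodalg := [ffun i => x i + y i : A i].
Let mul x y : prodalg := [ffun i => x i * y i : A i].
Let scale (c : k) x : prodalg := [ffun i => c *: x i : A i].

Fact prodalg_addA : associative add.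
Proof. by move=> x y z; apply/ffunP=> i; rewrite !ffunE addrA. Qed.
Fact prodalg_addC : commutative add.
Proof. by move=> x y; apply/ffunP=> i; rewrite !ffunE addrC. Qed.
Fact prodalg_add0 : left_id zero add.
Proof. by move=> x; apply/ffunP=> i; rewrite !ffunE add0r. Qed.
Fact prodalg_addN : left_inverse zero opp add.
Proof. by move=> x; apply/ffunP=> i; rewrite !ffunE addNr. Qed.

HB.instance Definition _ := GRing.isZmodule.Build prodalg
  prodalg_addA prodalg_addC prodalg_add0 prodalg_addN.

Fact prodalg_scaleA (c d : k) x : scale c (scale d x) = scale (c * d) x.
Proof. by apply/ffunP=> i; rewrite !ffunE scalerA. Qed.
Fact prodalg_scale1 : left_id 1 scale.
Proof. by move=> x; apply/ffunP=> i; rewrite !ffunE scale1r. Qed.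
Fact prodalg_scaleDr : right_distributive scale +%R.
Proof. by move=> c x y; apply/ffunP=> i; rewrite !ffunE scalerDr. Qed.
Fact prodalg_scaleDl x : {morph scale^~ x : c d / c + d}.
Proof. by move=> c d; apply/ffunP=> i; rewrite !ffunE scalerDl. Qed.

HB.instance Definition _ := GRing.Zmodule_isLmodule.Build k prodalg
  prodalg_scaleA prodalg_scale1 prodalg_scaleDr prodalg_scaleDl.

Lemma prodalg0E i : (0 : prodalg) i = 0. Proof. exact: ffunE. Qed.
Lemma prodalgNE x i : (- x) i = - x i. Proof. exact: ffunE. Qed.
Lemma prodalgDE x y i : (x + y) i = x i + y i. Proof. exact: ffunE. Qed.
Lemma prodalgZE c x i : (c *: x) i = c *: x i. Proof. exact: ffunE. Qed.

Let ix := {i : I & 'I_(dim (A i))}.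

Fact prodalg_vect : Vector.axiom #|{: ix}| prodalg.
Proof.
pose f x : 'rV[k]_#|{: ix}| :=
  \row_j v2r (x (tag (enum_val j))) 0 (tagged (enum_val j)).
pose g (r : 'rV[k]_#|{: ix}|) : prodalg :=
  [ffun i => r2v
     (\row_(j < dim (A i)) r 0 (enum_rank (Tagged (fun i => 'I_(dim (A i))) j)))].
exists f.
  by move=> c x y; apply/rowP=> j; rewrite !mxE prodalgDE prodalgZE linearP !mxE.
exists g => [x|r].
  apply/ffunP=> i; rewrite ffunE; apply: v2r_inj.
  by rewrite r2vK; apply/rowP=> j; rewrite !mxE enum_rankK.
apply/rowP=> j; rewrite !mxE ffunE r2vK mxE.
by congr (r 0 _); rewrite -[RHS]enum_valK; case: (enum_val j).
Qed.

HB.instance Definition _ := Lmodule_hasFinDim.Build k prodalg prodalg_vect.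

Fact prodalg_mulA : associative mul.
Proof. by move=> x y z; apply/ffunP=> i; rewrite !ffunE mulrA. Qed.
Fact prodalg_mul1l : left_id one mul.
Proof. by move=> x; apply/ffunP=> i; rewrite !ffunE mul1r. Qed.
Fact prodalg_mul1r : right_id one mul.
Proof. by move=> x; apply/ffunP=> i; rewrite !ffunE mulr1. Qed.
Fact prodalg_mul_linear_l y : linear (mul^~ y).
Proof. by move=> c u v; apply/ffunP=> i; rewrite !ffunE mulrDl fd_scalerAl. Qed.
Fact prodalg_mul_linear_r x : linear (mul x).
Proof. by move=> c u v; apply/ffunP=> i; rewrite !ffunE mulrDr fd_scalerAr. Qed.

HB.instance Definition _ := isFdAlgebra.Build k prodalg
  prodalg_mulA prodalg_mul1l prodalg_mul1r
  prodalg_mul_linear_l prodalg_mul_linear_r.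
HB.instance Definition _ := GRing.PzRing.copy prodalg (prodalg : fdAlgType k).

Lemma prodalg1E i : (1 : prodalg) i = 1. Proof. exact: ffunE. Qed.
Lemma prodalgME x y i : (x * y) i = x i * y i. Proof. exact: ffunE. Qed.

End ProductAlgebra.

(* The objects of mod A: since A is finite-dimensional over k, a right
   A-module is finitely generated iff it is finite-dimensional over k, so the
   carrier is a vectType. The k-structure is the one induced by
   k -> A, i.e. v * (c 1) = c v, as forced by ract_linear_r and ract1. *)
HB.mixin Record isRightModule (k : fieldType) (A : fdAlgType k) M
    of Vector k M := {
  ract : M -> A -> M;
  ract_linear_l : forall a : A, linear (ract^~ a);
  ract_linear_r : forall v : M, linear (ract v);
  ract1 : forall v : M, ract v 1 = v;
  ractM : forall (v : M) (a b : A), ract v (a * b) = ract (ract v a) b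
}.

#[short(type="rmodType")]
HB.structure Definition RightModule (k : fieldType) (A : fdAlgType k) :=
  { M of isRightModule k A M & Vector k M }.

Section Hom.
Variables (k : fieldType) (A : fdAlgType k).

Definition ractr (M : rmodType A) (a : A) (v : M) : M := ract v a.

HB.instance Definition _ (M : rmodType A) (a : A) :=
  GRing.isLinear.Build k M M _ (@ractr M a) (ract_linear_l a).
HB.instance Definition _ (M : rmodType A) (v : M) :=
  GRing.isLinear.Build k A M _ (@ract k A M v) (ract_linear_r v).

Definition rlinear (M N : rmodType A) (f : 'Hom(M, N)) : Prop :=
  forall v (a : A), f (ract v a) = ract (f v) a.

Definition rmod_iso (M N : rmodType A) : Prop :=
  exists2 f : 'Hom(M, N), rlinear f & bijective f.

Let defect (M N : rmodType A) (f : 'Hom(M, N)) :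
    {ffun 'I_(\dim {:A}) -> 'Hom(M, N)} :=
  [ffun i : 'I_(\dim {:A}) =>
     (f \o linfun (@ractr M (vbasis {:A})`_i))%VF
     - (linfun (@ractr N (vbasis {:A})`_i) \o f)%VF].

Let defectE (M N : rmodType A) (f : 'Hom(M, N)) i v :
  defect f i v = f (ract v (vbasis {:A})`_i) - ract (f v) (vbasis {:A})`_i.
Proof. by rewrite ffunE add_lfunE opp_lfunE !comp_lfunE !lfunE. Qed.

Fact defect_linear (M N : rmodType A) : linear (@defect M N).
Proof.
move=> c f g; apply/ffunP=> i; apply/lfunP=> v.
have -> : (c *: defect f + defect g) i = c *: defect f i + defect g i.
  by rewrite !ffunE.
rewrite add_lfunE scale_lfunE !defectE.
rewrite !add_lfunE !scale_lfunE -![ract _ _]/(ractr _ _) linearP.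
by rewrite scalerBr opprD addrACA.
Qed.

HB.instance Definition _ (M N : rmodType A) :=
  GRing.isLinear.Build k 'Hom(M, N) _ _ (@defect M N) (@defect_linear M N).

(* Hom_A(M, N), as a k-subspace of Hom_k(M, N). *)
Definition homA (M N : rmodType A) : {vspace 'Hom(M, N)} :=
  lker (linfun (@defect M N)).

Lemma homAP (M N : rmodType A) (f : 'Hom(M, N)) :
  reflect (rlinear f) (f \in homA M N).
Proof.
rewrite memv_ker lfunE /=; apply: (iffP eqP) => [f0 v a|fA]; last first.
  apply/ffunP=> i; apply/lfunP=> v.
  by rewrite defectE fA subrr ffunE zero_lfunE.
rewrite (coord_vbasis (memvf a)) !linear_sum /=.
apply: eq_bigr => i _; rewrite !linearZ /=; congr (_ *: _).
by apply/eqP; rewrite -subr_eq0 -defectE f0 ffunE zero_lfunE.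
Qed.

End Hom.

Section Kernel.
Variables (k : fieldType) (A : fdAlgType k) (M N : rmodType A).
Variables (f : 'Hom(M, N)) (fA : rlinear f).

Definition rker of rlinear f := subvs_of (lker f).
Local Notation K := (rker fA).

HB.instance Definition _ := Vector.on K.

Fact rker_stable (v : K) (a : A) : ract (vsval v) a \in lker f.
Proof.
rewrite memv_ker fA; have /eqP-> : f (vsval v) == 0 by rewrite -memv_ker subvsP.
by rewrite -[ract _ _]/(ractr a 0) linear0.
Qed.

Let kact (v : K) (a : A) : K := Subvs (rker_stable v a).

Fact rker_linear_l a : linear (kact^~ a).
Proof.
by move=> c u v; apply: val_inj; rewrite /= ract_linear_l.
Qed.
Fact rker_linear_r v : linear (kact v).
Proof. by move=> c a b; apply: val_inj; rewrite /= ract_linear_r. Qed.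
Fact rker_act1 v : kact v 1 = v.
Proof. by apply: val_inj; rewrite /= ract1. Qed.
Fact rker_actM v a b : kact v (a * b) = kact (kact v a) b.
Proof. by apply: val_inj; rewrite /= ractM. Qed.

HB.instance Definition _ := isRightModule.Build k A K
  rker_linear_l rker_linear_r rker_act1 rker_actM.

Definition rker_incl : 'Hom(K, M) := linfun (vsval : K -> M).

End Kernel.

Section FreeModule.
Variables (k : fieldType) (A : fdAlgType k) (n : nat).

Definition rfree := {ffun 'I_n -> A}.

HB.instance Definition _ := Vector.on rfree.

Let fact (v : rfree) (a : A) : rfree := [ffun i => v i * a].

Fact rfree_linear_l a : linear (fact^~ a).
Proof.
by move=> c u v; apply/ffunP=> i; rewrite !ffunE mulrDl fd_scalerAl.
Qed.
Fact rfree_linear_r v : linear (fact v).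
Proof.
by move=> c a b; apply/ffunP=> i; rewrite !ffunE mulrDr fd_scalerAr.
Qed.
Fact rfree_act1 v : fact v 1 = v.
Proof. by apply/ffunP=> i; rewrite !ffunE mulr1. Qed.
Fact rfree_actM v a b : fact v (a * b) = fact (fact v a) b.
Proof. by apply/ffunP=> i; rewrite !ffunE mulrA. Qed.

HB.instance Definition _ := isRightModule.Build k A rfree
  rfree_linear_l rfree_linear_r rfree_act1 rfree_actM.

End FreeModule.

Section Ext1.
Variables (k : fieldType) (A : fdAlgType k).

(* The surjection A^n -> M sending the i-th generator to the i-th vector of a
   k-basis of M. *)
Let cover (M : rmodType A) (x : rfree A (\dim {:M})) : M :=
  \sum_(i < \dim {:M}) ract (vbasis {:M})`_i (x i).

Fact cover_linear (M : rmodType A) : linear (@cover M).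
Proof.
move=> c x y; rewrite /cover scaler_sumr -big_split /=.
by apply: eq_bigr => i _; rewrite !ffunE linearP.
Qed.

HB.instance Definition _ (M : rmodType A) :=
  GRing.isLinear.Build k _ M _ (@cover M) (@cover_linear M).

Definition free_cover (M : rmodType A) : 'Hom(rfree A (\dim {:M}), M) :=
  linfun (@cover M).

Lemma free_cover_rlinear (M : rmodType A) : rlinear (free_cover M).
Proof.
move=> x a; rewrite !lfunE /= /cover -[RHS]/(ractr a _) linear_sum /=.
by apply: eq_bigr => i _; rewrite ffunE ractM.
Qed.

Lemma free_cover_surj (M : rmodType A) : limg (free_cover M) = fullv.
Proof.
apply/eqP; rewrite eqEsubv subvf; apply/subvP=> v _.
rewrite (coord_vbasis (memvf v)).
pose x : rfree A (\dim {:M}) := [ffun i => coord (vbasis {:M}) i v *: (1 : A)].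
suff -> : \sum_(i < \dim {:M}) coord (vbasis {:M}) i v *: (vbasis {:M})`_i
        = free_cover M x by exact: memv_img (memvf _).
rewrite lfunE /= /cover; apply: eq_bigr => i _.
by rewrite ffunE linearZ /= ract1.
Qed.

Definition syzygy (M : rmodType A) : rmodType A :=
  rker (@free_cover_rlinear M).

Definition syzygy_incl (M : rmodType A) :
    'Hom(syzygy M, rfree A (\dim {:M})) :=
  rker_incl (@free_cover_rlinear M).

Let restr (M N : rmodType A) (f : 'Hom(rfree A (\dim {:M}), N)) :
    'Hom(syzygy M, N) := (f \o syzygy_incl M)%VF.

Fact restr_linear (M N : rmodType A) : linear (@restr M N).
Proof. by move=> c f g; rewrite /restr comp_lfunDl comp_lfunZl. Qed.

HB.instance Definition _ (M N : rmodType A) :=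
  GRing.isLinear.Build k _ _ _ (@restr M N) (@restr_linear M N).

(* Those A-linear maps from the syzygy that extend to the free module. *)
Definition ext1_bound (M N : rmodType A) : {vspace 'Hom(syzygy M, N)} :=
  (linfun (@restr M N) @: homA (rfree A (\dim {:M})) N)%VS.

Lemma ext1_bound_sub (M N : rmodType A) :
  (ext1_bound M N <= homA (syzygy M) N)%VS.
Proof.
apply/subvP=> _ /memv_imgP[f /homAP fA ->]; apply/homAP=> v a.
by rewrite (lfunE (@restr M N)) /= !comp_lfunE !lfunE /= -fA.
Qed.

(* From 0 -> syzygy M -> A^n -> M -> 0 and Ext^1_A(A^n, N) = 0,
   Ext^1_A(M, N) = coker (Hom_A(A^n, N) -> Hom_A(syzygy M, N)). *)
Definition dim_ext1 (M N : rmodType A) : nat :=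
  (\dim (homA (syzygy M) N) - \dim (ext1_bound M N))%N.

End Ext1.

Section FrobeniusPerron.
Variables (k : fieldType) (A : fdAlgType k).

(* The ring End_A(S) is a division ring. *)
Definition brick (S : rmodType A) : Prop :=
  (\1%VF : 'End(S)) <> 0 /\
  forall f : 'End(S), rlinear f -> f <> 0 ->
    exists g : 'End(S), [/\ rlinear g, (g \o f)%VF = \1%VF & (f \o g)%VF = \1%VF].

(* A finite semibrick, as the family of its n pairwise non-isomorphic
   members. *)
Definition semibrick n (S : 'I_n -> rmodType A) : Prop :=
  [/\ forall i, brick (S i),
      forall i j, i != j -> ~ rmod_iso (S i) (S j)
    & forall i j, i != j -> forall f : 'Hom(S i, S j), rlinear f -> f = 0].

Variable R : realType.

Definition ext_quiver_adjacency n (S : 'I_n -> rmodType A) : 'M[R[i]]_n :=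
  \matrix_(i, j) (dim_ext1 (S i) (S j))%:R.

(* For n = 0 there is no eigenvalue, and sup set0 = 0. *)
Definition spectral_radius n (Q : 'M[R[i]]_n) : R :=
  sup [set Normc.normc z | z in [set z | eigenvalue Q z]]%classic.

Definition FPdim : \bar R :=
  ereal_sup [set x | exists n (S : 'I_n -> rmodType A),
    semibrick S /\ x = (spectral_radius (ext_quiver_adjacency S))%:E]%classic.

End FrobeniusPerron.

Arguments FPdim {k} A R.

From mathcomp Require Import falgebra.

Section FromFalgType.
Variables (k : fieldType) (A : falgType k).

Fact falg_mul_linear_l (y : A) : linear ( *%R^~ y).
Proof. by move=> c u v; rewrite mulrDl scalerAl. Qed.
Fact falg_mul_linear_r (x : A) : linear ( *%R x).
Proof. by move=> c u v; rewrite mulrDr scalerAr. Qed.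

Definition fdalg_of_falg : fdAlgType k :=
  HB.pack (Falgebra.sort A) (isFdAlgebra.Build k (Falgebra.sort A)
    (@mulrA A) (@mul1r A) (@mulr1 A) falg_mul_linear_l falg_mul_linear_r).

End FromFalgType.

(* Main.v *)
Require Import Defs.
From HB Require Import structures.
From mathcomp Require Import all_boot all_order all_algebra.
From mathcomp Require Import all_classical all_reals ereal.
From mathcomp Require Import complex.

(* The central idempotents e_b of the product act on a brick as orthogonal
   idempotent endomorphisms summing to 1, so exactly one of them acts as the
   identity: every brick is inflated from one factor. Inflation from a factor
   preserves Hom and Ext^1, and Ext^1 vanishes between different factors.
   Hence the adjacency matrix of a semibrick over the product is block diagonal
   with blocks coming from semibricks over the factors, and an eigenvector of
   it restricts to an eigenvector of some block. *)

Set Implicit Arguments.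
Unset Strict Implicit.
Unset Printing Implicit Defensive.

Import Order.TTheory GRing.Theory Num.Theory.
Local Open Scope ring_scope.

(** * Central idempotents of the product algebra *)

Section BlockIdempotents.
Variables (k : fieldType) (I : finType) (A : I -> fdAlgType k).
Implicit Types (b c : I) (x y : prodalg A).

(** Extension by zero, a section of the projection to [A b] that sends 1 to the idempotent e_b;
    [dfwith] copes with components of varying type. *)
Definition block_incl b (a : A b) : prodalg A :=
  [ffun j => eqtype.dfwith (fun j => 0 : A j) a j : A j].

Lemma block_inclE b (a : A b) : block_incl a b = a.
Proof. by rewrite ffunE eqtype.dfwith_in. Qed.

Lemma block_incl_out b (a : A b) c : b != c -> block_incl a c = 0.
Proof. by move=> bc; rewrite ffunE eqtype.dfwith_out. Qed.

Fact block_incl_linear b : linear (@block_incl b).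
Proof.
move=> c u v; apply/ffunP=> j; rewrite prodalgDE prodalgZE.
have [<-|bj] := eqVneq b j; first by rewrite !block_inclE.
by rewrite !block_incl_out // scaler0 addr0.
Qed.

HB.instance Definition _ b :=
  GRing.isLinear.Build k (A b) (prodalg A) _ (@block_incl b)
    (@block_incl_linear b).

Lemma block_inclM b (a a' : A b) :
  block_incl (a * a') = block_incl a * block_incl a'.
Proof.
apply/ffunP=> j; rewrite prodalgME.
have [<-|bj] := eqVneq b j; first by rewrite !block_inclE.
by rewrite !block_incl_out // mulr0.
Qed.

Definition block_idem b : prodalg A := block_incl (1 : A b).

Lemma block_idem_mulr b x : x * block_idem b = block_incl (x b).
Proof.
apply/ffunP=> j; rewrite prodalgME.
have [<-|bj] := eqVneq b j; first by rewrite !block_inclE mulr1.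
by rewrite !block_incl_out // mulr0.
Qed.

Lemma block_idem_mull b x : block_idem b * x = block_incl (x b).
Proof.
apply/ffunP=> j; rewrite prodalgME.
have [<-|bj] := eqVneq b j; first by rewrite !block_inclE mul1r.
by rewrite !block_incl_out // mul0r.
Qed.

Lemma block_idemC b x : block_idem b * x = x * block_idem b.
Proof. by rewrite block_idem_mull block_idem_mulr. Qed.

Lemma sum_block_idem : \sum_b block_idem b = 1 :> prodalg A.
Proof.
apply/ffunP=> j; rewrite prodalg1E.
have -> : (\sum_b block_idem b) j = \sum_b block_idem b j.
  by apply: (big_morph (fun x : prodalg A => x j)) => [x y|];
    rewrite ?prodalgDE ?prodalg0E.
rewrite (bigD1 j) //= block_inclE big1 ?addr0 // => b bj.
by rewrite block_incl_out.
Qed.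

End BlockIdempotents.

(** * Modules over one factor as modules over the product *)

Section Inflation.
Variables (k : fieldType) (I : finType) (A : I -> fdAlgType k) (b : I).

Section Structure.
Variable M : rmodType (A b).

(** The carrier is kept, so linear maps, dimensions and [vbasis] are literally shared with [M]; the
    product acts through its projection to [A b]. *)
Definition inflation : Type := M.

HB.instance Definition _ := Vector.on inflation.

Let iact (v : inflation) (x : prodalg A) : inflation := ract (v : M) (x b).

Fact inflation_linear_l x : linear (iact^~ x).
Proof. exact: ract_linear_l. Qed.
Fact inflation_linear_r v : linear (iact v).
Proof. by move=> c x y; rewrite /iact prodalgDE prodalgZE ract_linear_r. Qed.
Fact inflation_act1 v : iact v 1 = v.
Proof. by rewrite /iact prodalg1E ract1. Qed.
Fact inflation_actM v x y : iact v (x * y) = iact (iact v x) y.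
Proof. by rewrite /iact prodalgME ractM. Qed.

HB.instance Definition _ := isRightModule.Build k (prodalg A) inflation
  inflation_linear_l inflation_linear_r inflation_act1 inflation_actM.

End Structure.

Section Restriction.
Variable M : rmodType (prodalg A).
Hypothesis Mb : forall v : M, ract v (block_idem A b) = v.

(** The hypothesis is an argument of the type because 1 acts through e_b here: the unit law is
    exactly this hypothesis. *)
Definition block_restriction of (forall v : M, ract v (block_idem A b) = v) :
  Type := M.
Local Notation N := (block_restriction Mb).

HB.instance Definition _ := Vector.on N.

Let bact (v : N) (a : A b) : N := ract (v : M) (block_incl a).

Fact block_restriction_linear_l a : linear (bact^~ a).
Proof. exact: ract_linear_l. Qed.
Fact block_restriction_linear_r v : linear (bact v).
Proof. by move=> c x y; rewrite /bact block_incl_linear ract_linear_r. Qed.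
Fact block_restriction_act1 v : bact v 1 = v.
Proof. exact: Mb. Qed.
Fact block_restriction_actM v x y : bact v (x * y) = bact (bact v x) y.
Proof. by rewrite /bact block_inclM ractM. Qed.

HB.instance Definition _ := isRightModule.Build k (A b) N
  block_restriction_linear_l block_restriction_linear_r
  block_restriction_act1 block_restriction_actM.

End Restriction.

End Inflation.

(** The axioms are propositions, so by proof irrelevance the action determines the structure. *)
Lemma isRightModule_ext (k : fieldType) (A : fdAlgType k) (V : vectType k)
    (m1 m2 : isRightModule k A V) :
  isRightModule.ract m1 = isRightModule.ract m2 -> m1 = m2.
Proof.
case: m1 m2 => [r1 a1 b1 c1 d1] [r2 a2 b2 c2 d2] /= r12.
by case: _ / r12 a2 b2 c2 d2 => *; congr isRightModule.Axioms_;
  exact: Prop_irrelevance.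
Qed.

(* The equality of modules is strict because both sides have the same carrier;
   in particular they share the k-basis used to define dim_ext1. *)
Lemma inflationK (k : fieldType) (I : finType) (A : I -> fdAlgType k) b
    (M : rmodType (prodalg A)) :
  (forall v : M, ract v (block_idem A b) = v) ->
  exists N : rmodType (A b), inflation N = M :> rmodType (prodalg A).
Proof.
move=> Mb; exists (block_restriction Mb).
(* Unpacking [M] exposes the vector space structure common to both sides; only the actions remain to
   be compared. *)
move: (Mb); case: M Mb => V [m1 m2 m3 m4 m5 m6 m7 m8 m9 m10 m11 m] Mb Mb'.
refine (congr1 (fun m0 => RightModule.Pack (@RightModule.Class _ _ V
  m1 m2 m3 m4 m5 m6 m7 m8 m9 m10 m11 m0)) (_ : _ = m)).
apply: (@isRightModule_ext k _ (RightModule.Pack (RightModule.Class m))).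
apply/funext=> v; apply/funext=> x.
rewrite -[RHS]/(ract (v : RightModule.Pack (RightModule.Class m)) x).
(* v x = (v e_b) x = v (e_b x), and e_b x is the extension by zero of [x b]. *)
by rewrite -[in RHS](Mb' v) -ractM block_idem_mull.
Qed.

(** * Homomorphisms and semibricks under inflation *)

Section InflationHom.
Variables (k : fieldType) (I : finType) (A : I -> fdAlgType k) (b : I).
Implicit Types M N : rmodType (A b).

Lemma ract_inflation M (v : inflation M) (x : prodalg A) :
  ract v x = ract (v : M) (x b).
Proof. by []. Qed.

Lemma inflation_idem M (v : inflation M) : ract v (block_idem A b) = v.
Proof. by rewrite ract_inflation block_inclE ract1. Qed.

Lemma inflation_idem_out M c (v : inflation M) :
  c != b -> ract v (block_idem A c) = 0.
Proof.
move=> cb; rewrite ract_inflation block_incl_out //.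
exact: (linear0 (@ract k (A b) M v)).
Qed.

(** The projection to [A b] is onto: [a] is the component at [b] of [block_incl a]. *)
Lemma rlinear_inflation M N (f : 'Hom(M, N)) :
  @rlinear k (prodalg A) (inflation M) (inflation N) f <-> rlinear f.
Proof.
split=> fA v a; last exact: fA.
by have := fA v (block_incl a); rewrite !ract_inflation /= block_inclE.
Qed.

Lemma rmod_iso_inflation M N : rmod_iso (inflation M) (inflation N) <-> rmod_iso M N.
Proof. by split=> -[f fA fbij]; exists f => //; exact/rlinear_inflation. Qed.

End InflationHom.

Lemma brick_inflation (k : fieldType) (I : finType) (A : I -> fdAlgType k) b
    (M : rmodType (A b)) :
  brick (inflation M) <-> brick M.
Proof.
split=> -[M0 Mdiv]; split=> // f /rlinear_inflation fA f0;
  by have [g [/rlinear_inflation gA gf fg]] := Mdiv f fA f0; exists g.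
Qed.

Lemma semibrick_inflation (k : fieldType) (I : finType) (A : I -> fdAlgType k) b
    n (S : 'I_n -> rmodType (A b)) :
  semibrick (fun i => inflation (S i) : rmodType (prodalg A)) <-> semibrick S.
Proof.
split=> -[Sb Sni S0]; split=> [i|i j ij|i j ij f].
- exact/brick_inflation/Sb.
- by move=> /rmod_iso_inflation; exact: Sni.
- by move=> /rlinear_inflation; exact: S0.
- exact/brick_inflation/Sb.
- by move=> /rmod_iso_inflation; exact: Sni.
- by move=> /rlinear_inflation; exact: S0.
Qed.

(** Serves to extract from a semibrick the members lying over one factor. *)
Lemma semibrick_comp (k : fieldType) (A : fdAlgType k) n m
    (S : 'I_n -> rmodType A) (h : 'I_m -> 'I_n) :
  injective h -> semibrick S -> semibrick (S \o h).
Proof.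
move=> h_inj [Sb Sni S0]; split=> [i|i j ij|i j ij].
- exact: Sb.
- by apply: Sni; rewrite (inj_eq h_inj).
- by apply: S0; rewrite (inj_eq h_inj).
Qed.

(** * Ext^1 under inflation *)

Lemma ext1_boundP (k : fieldType) (A : fdAlgType k) (M N : rmodType A)
    (g : 'Hom(syzygy M, N)) :
  g \in ext1_bound M N <->
  exists2 f : 'Hom(rfree A (\dim {:M}), N),
    rlinear f & forall v : syzygy M, g v = f (vsval v).
Proof.
(* The linear structure declared on the restriction map in the definition of
   ext1_bound is not inferred here, because that map was a local Let. *)
pose rL := GRing.isLinear.Build k _ _ _ _ (@restr_linear k A M N).
pose restr : {linear 'Hom(rfree A (\dim {:M}), N) -> 'Hom(syzygy M, N)} :=
  HB.pack (fun f : 'Hom(rfree A (\dim {:M}), N) => (f \o syzygy_incl M)%VF) rL.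
have restrE f v : linfun restr f v = f (vsval v).
  by rewrite lfunE /= comp_lfunE lfunE.
split=> [/memv_imgP[f /homAP fA ->]|[f fA gf]].
  by exists f => // v; exact: restrE.
apply/memv_imgP; exists f; first exact/homAP.
by apply/lfunP=> v; rewrite gf -restrE.
Qed.

Section InflationExt.
Variables (k : fieldType) (I : finType) (A : I -> fdAlgType k) (b : I).
Local Notation P := (prodalg A).
Local Notation B := (A b).

Section Free.
Variable n : nat.

Definition free_proj (x : rfree P n) : rfree B n := [ffun i => x i b].

Fact free_proj_linear : linear free_proj.
Proof.
by move=> c x y; apply/ffunP=> i; rewrite !ffunE.
Qed.

HB.instance Definition _ :=
  GRing.isLinear.Build k (rfree P n) (rfree B n) _ free_proj free_proj_linear.

Definition free_incl (y : rfree B n) : rfree P n := [ffun i => block_incl (y i)].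

Fact free_incl_linear : linear free_incl.
Proof. by move=> c x y; apply/ffunP=> i; rewrite !ffunE linearP. Qed.

HB.instance Definition _ :=
  GRing.isLinear.Build k (rfree B n) (rfree P n) _ free_incl free_incl_linear.

Lemma free_projM x a : free_proj (ract x a) = ract (free_proj x) (a b).
Proof. by apply/ffunP=> i; rewrite !ffunE. Qed.

Lemma free_inclM y a : free_incl (ract y a) = ract (free_incl y) (block_incl a).
Proof. by apply/ffunP=> i; rewrite 4!ffunE block_inclM. Qed.

Lemma free_inclK : cancel free_incl free_proj.
Proof. by move=> y; apply/ffunP=> i; rewrite 2!ffunE block_inclE. Qed.

Lemma free_projK x : free_incl (free_proj x) = ract x (block_idem A b).
Proof. by apply/ffunP=> i; rewrite 3!ffunE block_idem_mulr. Qed.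

End Free.

Variables M N : rmodType B.
Local Notation n := (\dim {:M}).

(** Both covers are built from the same basis of the common carrier. *)
Lemma free_cover_proj (x : rfree P n) :
  free_cover (inflation M) x = free_cover M (free_proj x).
Proof.
rewrite !lfunE /=; apply: eq_bigr => i _.
by rewrite ract_inflation ffunE.
Qed.

Fact syzygy_proj_subproof (v : syzygy (inflation M)) :
  free_proj (vsval v : rfree P n) \in lker (free_cover M).
Proof. by rewrite memv_ker -free_cover_proj -memv_ker subvsP. Qed.

(** The syzygy over the product is the one over [A b] plus the free summands of all other factors;
    this map discards the latter. *)
Definition syzygy_proj (v : syzygy (inflation M)) : syzygy M :=
  Subvs (syzygy_proj_subproof v).

Fact syzygy_proj_linear : linear syzygy_proj.
Proof. by move=> c u v; apply: val_inj; rewrite /= !linearP. Qed.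

HB.instance Definition _ :=
  GRing.isLinear.Build k _ _ _ syzygy_proj syzygy_proj_linear.

Fact syzygy_lift_subproof (w : syzygy M) :
  free_incl (vsval w : rfree B n) \in lker (free_cover (inflation M)).
Proof.
by rewrite memv_ker free_cover_proj free_inclK -memv_ker subvsP.
Qed.

Definition syzygy_lift (w : syzygy M) : syzygy (inflation M) :=
  Subvs (syzygy_lift_subproof w).

Fact syzygy_lift_linear : linear syzygy_lift.
Proof. by move=> c u v; apply: val_inj; rewrite /= !linearP. Qed.

HB.instance Definition _ :=
  GRing.isLinear.Build k _ _ _ syzygy_lift syzygy_lift_linear.

Lemma syzygy_liftK : cancel syzygy_lift syzygy_proj.
Proof. by move=> w; apply: val_inj; rewrite /= free_inclK. Qed.

Lemma syzygy_projK v : syzygy_lift (syzygy_proj v) = ract v (block_idem A b).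
Proof. by apply: val_inj; rewrite /= free_projK. Qed.

Definition syzygy_pull (g : 'Hom(syzygy M, N)) :
    'Hom(syzygy (inflation M), inflation N) := (g \o linfun syzygy_proj)%VF.

Fact syzygy_pull_linear : linear syzygy_pull.
Proof. by move=> c f g; rewrite /syzygy_pull comp_lfunDl comp_lfunZl. Qed.

HB.instance Definition _ :=
  GRing.isLinear.Build k _ _ _ syzygy_pull syzygy_pull_linear.

(** [syzygy_proj] is surjective, with section [syzygy_lift]. *)
Lemma lker_syzygy_pull : lker (linfun syzygy_pull) == 0%VS.
Proof.
apply/lker0P=> f g; rewrite !lfunE /= => fg; apply/lfunP=> w.
by have /lfunP/(_ (syzygy_lift w)) := fg; rewrite !comp_lfunE !lfunE /= syzygy_liftK.
Qed.

(** Every h on the right factors through [syzygy_proj]: e_b is the identity on the target, so h v =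
    h (v e_b), and v e_b depends only on [syzygy_proj v]. *)
Lemma homA_syzygy_pull :
  (linfun syzygy_pull @: homA (syzygy M) N)%VS
    = homA (syzygy (inflation M)) (inflation N).
Proof.
apply/eqP; rewrite eqEsubv; apply/andP; split; apply/subvP=> h.
  move=> /memv_imgP[g /homAP gA ->]; apply/homAP=> v x.
  rewrite lfunE /= !comp_lfunE !lfunE /= ract_inflation -gA.
  by congr (g _); apply: val_inj; rewrite /= free_projM.
move=> /homAP hA; pose g : 'Hom(syzygy M, N) := (h \o linfun syzygy_lift)%VF.
have -> : h = linfun syzygy_pull g.
  apply/lfunP=> v; rewrite lfunE /= !comp_lfunE !lfunE /=.
  by rewrite syzygy_projK hA inflation_idem.
apply: memv_img; apply/homAP=> w a.
rewrite !comp_lfunE !lfunE /=.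
have -> : syzygy_lift (ract w a) = ract (syzygy_lift w) (block_incl a).
  by apply: val_inj; rewrite /= free_inclM.
by rewrite hA ract_inflation block_inclE.
Qed.

(** Extensions to the free cover are carried across by [free_proj] in one direction and by
    [free_incl] in the other. *)
Lemma ext1_bound_syzygy_pull :
  (linfun syzygy_pull @: ext1_bound M N)%VS
    = ext1_bound (inflation M) (inflation N).
Proof.
apply/eqP; rewrite eqEsubv; apply/andP; split; apply/subvP=> h.
  move=> /memv_imgP[g /ext1_boundP[f fA gf] ->]; apply/ext1_boundP.
  exists (f \o linfun (@free_proj n))%VF => [x a|v].
    by rewrite !comp_lfunE !lfunE /= free_projM fA ract_inflation.
  by rewrite lfunE /= !comp_lfunE !lfunE /= gf.
move=> /ext1_boundP[f fA hf].
have hA : rlinear h by move=> v x; rewrite !hf -fA.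
pose g : 'Hom(syzygy M, N) := (h \o linfun syzygy_lift)%VF.
have -> : h = linfun syzygy_pull g.
  apply/lfunP=> v; rewrite lfunE /= !comp_lfunE !lfunE /=.
  by rewrite syzygy_projK hA inflation_idem.
apply: memv_img; apply/ext1_boundP.
exists (f \o linfun (@free_incl n))%VF => [y a|w].
  rewrite !comp_lfunE !lfunE /= free_inclM fA.
  by rewrite ract_inflation block_inclE.
by rewrite !comp_lfunE !lfunE /= hf.
Qed.

Lemma dim_ext1_inflation : dim_ext1 (inflation M) (inflation N) = dim_ext1 M N.
Proof.
have dimE U : \dim (linfun syzygy_pull @: U)%VS = \dim U.
  by apply: limg_dim_eq; rewrite (eqP lker_syzygy_pull) capv0.
by rewrite /dim_ext1 -homA_syzygy_pull -ext1_bound_syzygy_pull !dimE.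
Qed.

End InflationExt.

(* A map h out of the syzygy of M extends to the free cover by x |-> h (x e_c):
   e_c maps the free module into the syzygy, since it kills M. *)
Lemma dim_ext1_cross_block (k : fieldType) (I : finType) (A : I -> fdAlgType k)
    b c (M : rmodType (A b)) (N : rmodType (A c)) :
  b != c -> dim_ext1 (inflation M) (inflation N) = 0%N.
Proof.
move=> bc; apply/eqP; rewrite subn_eq0; apply: dimvS.
apply/subvP=> h /homAP hA; apply/ext1_boundP.
set e := block_idem A c; set F := rfree (prodalg A) (\dim {:inflation M}).
have ker x : ractr e (x : F) \in lker (free_cover (inflation M)).
  rewrite memv_ker /ractr free_cover_rlinear.
  by rewrite inflation_idem_out // eq_sym.
pose p (x : F) : syzygy (inflation M) := Subvs (ker x).
have p_lin : linear p by move=> a x y; apply: val_inj; rewrite /= linearP.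
pose pL : {linear F -> syzygy (inflation M)} :=
  HB.pack p (GRing.isLinear.Build k _ _ _ p p_lin).
exists (h \o linfun pL)%VF => [x a|v].
  rewrite !comp_lfunE !lfunE /= -hA; congr (h _); apply: val_inj => /=.
  by rewrite /ractr -!ractM block_idemC.
(* On the syzygy, h v = (h v) e_c = h (v e_c), since e_c is the identity on the target. *)
rewrite comp_lfunE lfunE /= -[LHS]inflation_idem -hA.
by congr (h _); apply: val_inj.
Qed.

(** * Bricks over the product *)

Lemma brick_block (k : fieldType) (I : finType) (A : I -> fdAlgType k)
    (M : rmodType (prodalg A)) :
  brick M -> exists b, exists N : rmodType (A b), inflation N = M :> rmodType _.
Proof.
move=> [M0 Mdiv].
suff [b Mb] : exists b, forall v : M, ract v (block_idem A b) = v.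
  by exists b; exact: inflationK.
pose e b : 'End(M) := linfun (@ractr k (prodalg A) M (block_idem A b)).
have eE b v : e b v = ract v (block_idem A b) by rewrite lfunE.
have eA b : rlinear (e b) by move=> v a; rewrite !eE -!ractM block_idemC.
(* If every e_b acted as 0, so would their sum 1, and the identity of [M] would vanish. *)
have [b eb0] : exists b, e b <> 0.
  apply: contrapT => /forallNP e0; apply: M0; apply/lfunP=> v.
  rewrite id_lfunE zero_lfunE -[LHS]ract1 -sum_block_idem.
  rewrite (linear_sum (@ract k (prodalg A) M v)) big1 //= => b _.
  by rewrite -eE (contrapT (e0 b)) zero_lfunE.
(* Being nonzero, the action of e_b is invertible; an invertible idempotent is the identity. *)
exists b => v; have [g [_ ge _]] := Mdiv _ (eA b) eb0.
have geK w : g (e b w) = w by rewrite -comp_lfunE ge id_lfunE.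
rewrite -[LHS]geK !eE -ractM block_idem_mulr block_inclE.
by rewrite -[X in g X]eE geK.
Qed.

(** * Spectral radii and block decompositions *)

Section SpectralRadius.
Variable R : realType.
Local Notation C := R[i].

(** A crude bound suffices: it only has to make the set of moduli bounded above, so that [sup] is an
    upper bound. *)
Lemma eigenvalue_normc_le n (Q : 'M[C]_n) z :
  eigenvalue Q z -> Normc.normc z <= \sum_i \sum_j Normc.normc (Q i j).
Proof.
move=> /eigenvalueP[v vQ /rV0Pn[j0 vj0]].
have normc_ge0 (w : C) : 0 <= Normc.normc w by case: w => x y; exact: sqrtr_ge0.
(* Compare the entries of v Q = z v at an index where |v_j| is maximal. *)
pose j := [arg max_(j > j0) Normc.normc (v 0 j)]%O.
have jmax i : Normc.normc (v 0 i) <= Normc.normc (v 0 j).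
  by rewrite /j; case: arg_maxP => // ? _; exact.
have vj_gt0 : 0 < Normc.normc (v 0 j).
  apply: lt_le_trans (jmax j0); rewrite lt_def normc_ge0 andbT.
  by apply: contraNneq vj0 => /Normc.eq0_normc ->.
rewrite -(ler_pM2r vj_gt0) -Normc.normcM.
have -> : z * v 0 j = \sum_i v 0 i * Q i j.
  by have /rowP/(_ j) := vQ; rewrite !mxE.
apply: (@le_trans _ _ (\sum_i Normc.normc (v 0 i * Q i j))).
  elim/big_ind2: _ => [|x1 x2 y1 y2 h1 h2|//]; first by rewrite Normc.normc0.
  by apply: le_trans (le_normcD _ _) _; exact: lerD.
rewrite mulr_suml; apply: ler_sum => i _; rewrite Normc.normcM mulrC.
(* The entry [Q i j] is enlarged to the sum of its row. *)
apply: ler_pM => //; rewrite (bigD1 j) //= lerDl.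
by apply: sumr_ge0 => l _.
Qed.

Lemma normc_le_spectral_radius n (Q : 'M[C]_n) z :
  eigenvalue Q z -> Normc.normc z <= spectral_radius Q.
Proof.
move=> Qz; apply: ub_le_sup; last by exists z.
exists (\sum_i \sum_j Normc.normc (Q i j)) => _ [w Qw <-].
exact: eigenvalue_normc_le.
Qed.

(** The condition [0 <= m] covers a matrix without eigenvalues, where [sup] is 0. *)
Lemma spectral_radius_le n (Q : 'M[C]_n) (m : \bar R) :
  (0 <= m)%E -> (forall z, eigenvalue Q z -> ((Normc.normc z)%:E <= m)%E) ->
  ((spectral_radius Q)%:E <= m)%E.
Proof.
case: m => [m| |//]; last by move=> *; exact: leey.
rewrite !lee_fin => m0 Qm.
have [[x [z Qz _]]|/nonemptyPn E0] := pselect ([set Normc.normc z | z in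
    [set z | eigenvalue Q z]] !=set0)%classic.
  apply: ge_sup; first by exists (Normc.normc z), z.
  by move=> _ [w Qw <-]; exact: Qm.
by rewrite /spectral_radius E0 sup0.
Qed.

Lemma spectral_radius_mx0 (Q : 'M[C]_0) : spectral_radius Q = 0.
Proof.
have noQ z : ~ eigenvalue Q z by move=> /eigenvalueP[v _ /rV0Pn[[]]].
rewrite -[RHS](@sup0 R); congr sup.
by apply/seteqP; split=> // x [z /noQ[]].
Qed.

(** Restrict a row eigenvector to the class of one of its nonzero coordinates: rows of other classes
    contribute nothing to these columns. Classes need not be intervals, hence [enum_val]. *)
Lemma eigenvalue_block n (Q : 'M[C]_n) (T : eqType) (c : 'I_n -> T) z :
    (forall i j, c i != c j -> Q i j = 0) -> eigenvalue Q z ->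
  exists t, eigenvalue
    (mxsub (enum_val (A := [pred i | c i == t]))
           (enum_val (A := [pred i | c i == t])) Q) z.
Proof.
move=> Q0 /eigenvalueP[v vQ /rV0Pn[j0 vj0]]; exists (c j0).
set B := [pred i | c i == c j0].
apply/eigenvalueP; exists (colsub (enum_val (A := B)) v).
  apply/rowP=> l; rewrite !mxE.
  have /rowP/(_ (enum_val l)) := vQ; rewrite !mxE => <-.
  rewrite (bigID (mem B)) /= [X in _ + X]big1 ?addr0 => [|i iB].
    by rewrite [RHS]big_enum_val; apply: eq_bigr => i _; rewrite !mxE.
  rewrite Q0 ?mulr0 //; have := enum_valP l; rewrite inE => /eqP ->.
  by rewrite inE in iB.
have j0B : j0 \in B by rewrite inE.
by apply/rV0Pn; exists (enum_rank_in j0B j0); rewrite mxE enum_rankK_in.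
Qed.

End SpectralRadius.

(** * Frobenius-Perron dimension of the product *)

Section FPdimProduct.
Variables (R : realType) (k : fieldType).

(** The empty semibrick has spectral radius 0; [rfree A 0] is a mere placeholder. *)
Lemma FPdim_ge0 (A : fdAlgType k) : (0 <= FPdim A R)%E.
Proof.
apply: ereal_sup_ubound; exists 0%N.
exists (fun _ : 'I_0 => rfree A 0 : rmodType A).
by split; [split=> -[]|rewrite spectral_radius_mx0].
Qed.

Variables (I : finType) (A : I -> fdAlgType k).

(** Inflating a semibrick preserves its Ext-quiver. *)
Lemma FPdim_le_prod b : (FPdim (A b) R <= FPdim (prodalg A) R)%E.
Proof.
apply: ge_ereal_sup => _ [n [S [Ssemi ->]]]; apply: ereal_sup_ubound.
exists n, (fun i => inflation (S i) : rmodType (prodalg A)).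
split; first exact/semibrick_inflation.
congr (spectral_radius _)%:E; apply/matrixP=> i j.
by rewrite !mxE dim_ext1_inflation.
Qed.

Lemma spectral_radius_prod_le (m : \bar R) n (S : 'I_n -> rmodType (prodalg A)) :
    (0 <= m)%E -> (forall b, (FPdim (A b) R <= m)%E) -> semibrick S ->
  ((spectral_radius (ext_quiver_adjacency R S))%:E <= m)%E.
Proof.
move=> m0 Am Ssemi; apply: spectral_radius_le => // z.
(* [tag (p j)] is the factor over which [S j] lives; it labels the blocks. *)
have /choice[p pS] j : exists p : {b : I & rmodType (A b)},
    inflation (tagged p) = S j :> rmodType (prodalg A).
  have [Sb _ _] := Ssemi; have [b [N NS]] := brick_block (Sb j).
  by exists (Tagged (fun b => rmodType (A b)) N).
move=> /(eigenvalue_block (c := fun j => tag (p j)))[i j ij|b].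
  by rewrite mxE -!pS dim_ext1_cross_block.
set h := enum_val (A := _) => Qz.
(* All members enumerated by [h] have label [b]; eliminating this equality retypes them over
   [A b]. *)
have /choice[S' S'E] l : exists N : rmodType (A b),
    inflation N = S (h l) :> rmodType (prodalg A).
  have := enum_valP l; rewrite inE => /eqP; rewrite -/(h l) -(pS (h l)).
  by case: (p (h l)) => c N /= cb; case: _ / cb; exists N.
apply: le_trans (Am b).
apply: (@le_trans _ _ (spectral_radius (ext_quiver_adjacency R S'))%:E).
  rewrite lee_fin; apply: normc_le_spectral_radius.
  congr (eigenvalue _ z): Qz; apply/matrixP=> i j.
  by rewrite !mxE -!S'E dim_ext1_inflation.
apply: ereal_sup_ubound; exists _, S'; split=> //.
apply/semibrick_inflation.
have -> : (fun i => inflation (S' i) : rmodType (prodalg A)) = S \o h.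
  by apply/funext=> i; exact: S'E.
by apply: semibrick_comp Ssemi; exact: enum_val_inj.
Qed.

End FPdimProduct.

Theorem lemma2p4 (R : realType) (k : closedFieldType) (r : nat) (hr : (1 <= r)%N)
    (A : 'I_r -> fdAlgType k) :
  FPdim (prodalg A) R = \big[Order.max/-oo%E]_(i < r) FPdim (A i) R.
Proof.
have Amax b : (FPdim (A b) R <= \big[Order.max/-oo%E]_(i < r) FPdim (A i) R)%E.
  exact: le_bigmax.
apply/eqP; rewrite eq_le; apply/andP; split; last first.
  by apply: bigmax_le => [|b _]; [exact: leNye|exact: FPdim_le_prod].
apply: ge_ereal_sup => _ [n [S [Ssemi ->]]].
apply: spectral_radius_prod_le => //.
(* An empty maximum would be [-oo]; [hr] provides a factor, whose dimension is at least 0. *)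
exact: le_trans (FPdim_ge0 _ _) (Amax (Ordinal hr)).
Qed.
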